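(* Let $S\subseteq\mathbb{R}$. Then $S$ is bounded if and only if ${}^*S\subseteq\mathcal{F}({}^*\mathbb{R})$. Similarly, $S$ is bounded from above (respectively, from below) if and only if ${}^*S$ does not contain positive (respectively, negative) infinitely large numbers.
   Context: $\mathbb{R}_+$ is the set of positive real numbers and $\mathbb{N}=\{1,2,3,\dots\}$. Fix an ultrafilter $\mathcal{U}$ on $\mathbb{R}_+$ such that $(0,\tfrac1n)\in\mathcal{U}$ for all $n\in\mathbb{N}$. A property of $\varepsilon\in\mathbb{R}_+$ holds almost everywhere (a.e.) if the set of $\varepsilon$ for which it holds belongs to $\mathcal{U}$. For nets $(a_\varepsilon),(b_\varepsilon)\in\mathbb{C}^{\mathbb{R}_+}$ write $(a_\varepsilon)\sim(b_\varepsilon)$ if $a_\varepsilon=b_\varepsilon$ a.e.; $\langle a_\varepsilon\rangle$ is the equivalence class, and ${}^*\mathbb{C}=\mathbb{C}^{\mathbb{R}_+}/\!\sim$ with operations induced pointwise; $\mathbb{C}$ is embedded via constant nets. For $S\subseteq\mathbb{C}$, ${}^*S=\{\langle s_\varepsilon\rangle : s_\varepsilon\in S\text{ a.e.}\}$; in particular this defines ${}^*\mathbb{R}$, ordered by $\langle a_\varepsilon\rangle<\langle b_\varepsilon\rangle$ iff $a_\varepsilon<b_\varepsilon$ a.e. $\mathcal{F}({}^*\mathbb{R})=\{x\in{}^*\mathbb{R}:|x|\le n\text{ for some }n\in\mathbb{N}\}$ is the set of finite numbers; $x\in{}^*\mathbb{R}$ is infinitely large if $|x|>n$ for all $n\in\mathbb{N}$.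 $S\subseteq\mathbb{R}$ is bounded if there is $M\in\mathbb{R}_+$ with $|s|\le M$ for all $s\in S$. *)

(* Defs.v *)
From mathcomp Require Import all_boot all_order all_algebra.
From mathcomp Require Import generic_quotient.
From mathcomp Require Import complex.
From mathcomp Require Import all_classical all_reals all_analysis.

Set Implicit Arguments.
Unset Strict Implicit.
Unset Printing Implicit Defensive.

Import Order.TTheory GRing.Theory Num.Theory.
Local Open Scope classical_set_scope.
Local Open Scope quotient_scope.
Local Open Scope complex_scope.
Local Open Scope ring_scope.

Definition net (R : realType) (T : Type) : Type := {posnum R} -> T.

Section StarComplex.
Context {R : realType} (U : set_system {posnum R}) {UF : Filter U}.

(* [U X] reads "X holds almost everywhere". *)
Definition aeq (a b : net R R[i]) : bool := `[< U [set e | a e = b e] >].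

Lemma aeq_refl : reflexive aeq.
Proof. by move=> a; apply/asboolP; apply: filterS filterT. Qed.

Lemma aeq_sym : symmetric aeq.
Proof.
by move=> a b; apply/asboolP/asboolP; apply: filterS => e /= ->.
Qed.

Lemma aeq_trans : transitive aeq.
Proof.
move=> b a c /asboolP ab /asboolP bc; apply/asboolP.
by apply: filterS2 ab bc => e /= -> ->.
Qed.

Canonical aeq_equiv := EquivRel aeq aeq_refl aeq_sym aeq_trans.

Definition starC : Type := {eq_quot aeq_equiv}.

Definition hclass (a : net R R[i]) : starC := \pi_({eq_quot aeq_equiv}) a.

Lemma hclassP a b : hclass a = hclass b <-> U [set e | a e = b e].
Proof.
split=> [/eqP|ab].
  by rewrite /hclass eqquotE => /asboolP.
by apply/eqP; rewrite /hclass eqquotE; apply/asboolP.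
Qed.

Definition hconst (z : R[i]) : starC := hclass (fun=> z).

Definition habs (x : starC) : starC :=
  hclass (fun e => `|repr (x : {eq_quot aeq_equiv}) e|).

Lemma habsE a : habs (hclass a) = hclass (fun e => `|a e|).
Proof.
apply/hclassP.
have /hclassP : hclass (repr (hclass a : {eq_quot aeq_equiv})) = hclass a.
  exact: reprK.
by apply: filterS => e /= ->.
Qed.

Definition star (S : set R[i]) : set starC :=
  [set x | exists2 s : net R R[i], x = hclass s & U [set e | S (s e)]].

Definition starS (S : set R) : set starC := star [set s%:C | s in S].

Definition starR : set starC := starS setT.

(* The order of [starR] is the pointwise a.e. order on classes of real nets;
   elements of [starC] outside [starR] are not comparable. *)
Definition hlt (x y : starC) : Prop :=
  exists a b : net R R, [/\ x = hclass (fun e => (a e)%:C),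
    y = hclass (fun e => (b e)%:C) & U [set e | a e < b e]].

Definition hle (x y : starC) : Prop := hlt x y \/ (starR x /\ x = y).

Lemma hltE (a b : net R R) :
  hlt (hclass (fun e => (a e)%:C)) (hclass (fun e => (b e)%:C)) <->
  U [set e | a e < b e].
Proof.
split=> [[a' [b' [/hclassP aa' /hclassP bb' ab']]]|ab]; last by exists a, b.
by apply: filterS3 aa' bb' ab' => e /= [->] [->].
Qed.

Definition hfinite : set starC :=
  [set x | starR x /\
    exists n : nat, (0 < n)%N /\ hle (habs x) (hconst n%:R)].

Definition infinitely_large (x : starC) : Prop :=
  starR x /\ forall n : nat, (0 < n)%N -> hlt (hconst n%:R) (habs x).

Definition hpositive (x : starC) : Prop := hlt (hconst 0) x.

Definition hnegative (x : starC) : Prop := hlt x (hconst 0).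

End StarComplex.

Arguments starC {R} U {UF}.
Arguments star {R} U {UF} S _.
Arguments starS {R} U {UF} S _.
Arguments starR {R} U {UF} _.
Arguments hfinite {R} U {UF} _.

Definition bounded_reals (R : realType) (S : set R) : Prop :=
  exists M : R, 0 < M /\ forall s, S s -> `|s| <= M.

(* Main.v *)
(** Along the net e |-> 1/e, which exceeds every natural number a.e., an
    unbounded set yields a net of elements that is infinitely large; conversely
    a bound on S transfers to every class of nets in S.  The ultrafilter
    dichotomy turns "not finite" into "infinitely large". *)

Require Import Defs.
From mathcomp Require Import all_boot all_order all_algebra.
From mathcomp Require Import complex.
From mathcomp Require Import all_classical all_reals all_analysis.

Set Implicit Arguments.
Unset Strict Implicit.
Unset Printing Implicit Defensive.

Import Order.TTheory GRing.Theory Num.Theory.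
Local Open Scope classical_set_scope.
Local Open Scope ring_scope.

Section HyperrealNets.
Context {R : realType} (U : set_system {posnum R}) {UU : UltraFilter U}.

Let hreal (a : net R R) : starC U := hclass (fun e => (a e)%:C%C).

(** A representing net takes values in the image of [S] a.e., so passing to real parts alters it at
    most off a set of [U] and keeps the class. All later arguments can thus use real nets. *)
Lemma starSP (S : set R) (x : starC U) :
  starS U S x <-> exists2 a : net R R, x = hreal a & U [set e | S (a e)].
Proof.
split=> [[z -> Uz]|[a -> Ua]]; last first.
  by exists (fun e => (a e)%:C%C) => //; apply: filterS Ua => e Sa; exists (a e).
exists (fun e => complex.Re (z e)).
  by apply/hclassP; apply: filterS Uz => e /= [s _ <-].
by apply: filterS Uz => e /= [s Ss <-].
Qed.

Lemma starR_hreal (a : net R R) : starR U (hreal a).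
Proof. by apply/starSP; exists a => //; apply: filterS filterT. Qed.

Lemma habs_hreal (a : net R R) : habs (hreal a) = hreal (fun e => `|a e|).
Proof.
rewrite habsE; apply/hclassP; apply: filterS filterT => e _ /=.
by rewrite normc_def /= expr0n addr0 sqrtr_sqr.
Qed.

Lemma hconst_nat (n : nat) : hconst n%:R = hreal (fun=> n%:R).
Proof.
by apply/hclassP; apply: filterS filterT => e _ /=; rewrite rmorph_nat.
Qed.

Lemma hleE (a b : net R R) :
  hle (hreal a) (hreal b) <-> U [set e | a e <= b e].
Proof.
split=> [[/hltE|[_ /hclassP]]|ab].
- by apply: filterS => e /ltW.
- by apply: filterS => e /= [->].
(* [hle] asks for one alternative a.e., strict or equal, while [ab] allows a mixture; the
   ultrafilter decides which one prevails. *)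
have [lt_ab|nlt_ab] := in_ultra_setVsetC [set e | a e < b e] UU.
  by left; apply/hltE.
right; split; first exact: starR_hreal.
apply/hclassP; apply: filterS2 ab nlt_ab => e /= le_ab /negP.
by rewrite -leNgt => le_ba; congr (_%:C%C); apply/le_anti/andP.
Qed.

Lemma hfinite_hreal (a : net R R) : hfinite U (hreal a) <->
  exists2 n, (0 < n)%N & U [set e | `|a e| <= n%:R].
Proof.
rewrite /hfinite /= habs_hreal; split=> [[_ [n []]]|[n n0 le_an]].
  by rewrite hconst_nat => n0 /hleE; exists n.
by split; [exact: starR_hreal|exists n; rewrite hconst_nat hleE].
Qed.

Lemma infinitely_large_hreal (a : net R R) : infinitely_large (hreal a) <->
  forall n, (0 < n)%N -> U [set e | n%:R < `|a e|].
Proof.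
rewrite /infinitely_large habs_hreal; split=> [[_ lt_na] n /lt_na|lt_na].
  by rewrite hconst_nat hltE.
by split=> [|n /lt_na]; [exact: starR_hreal|rewrite hconst_nat hltE].
Qed.

(** For each [n], exactly one of the sets where [|a e| <= n] and where [n < |a e|] lies in [U]: they
    are disjoint and complementary. *)
Lemma hfinite_not_large (a : net R R) :
  hfinite U (hreal a) <-> ~ infinitely_large (hreal a).
Proof.
rewrite hfinite_hreal infinitely_large_hreal; split=> [[n n0 le_an] lt_na|].
  have [e /= []] := filter_ex (filterI le_an (lt_na n n0)).
  by rewrite leNgt => /negP.
apply: contra_notP => nfin n n0.
have [//|nlt_na] := in_ultra_setVsetC [set e | n%:R < `|a e|] UU.
case: nfin; exists n => //.
by apply: filterS nlt_na => e /= /negP; rewrite -leNgt.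
Qed.

Lemma hpositive_hreal (a : net R R) :
  hpositive (hreal a) <-> U [set e | 0 < a e].
Proof. by rewrite /hpositive (hconst_nat 0) hltE. Qed.

Lemma hnegative_hreal (a : net R R) :
  hnegative (hreal a) <-> U [set e | a e < 0].
Proof. by rewrite /hnegative (hconst_nat 0) hltE. Qed.

Lemma positive_large_hreal (a : net R R) :
  hpositive (hreal a) /\ infinitely_large (hreal a) <->
  forall n, (0 < n)%N -> U [set e | n%:R < a e].
Proof.
rewrite hpositive_hreal infinitely_large_hreal.
split=> [[a0 lt_na] n n0|lt_na]; last split.
- by apply: filterS2 a0 (lt_na n n0) => e /= a0; rewrite gtr0_norm.
(* The case [n = 1] already gives positivity, since [0 < 1]. *)
- by apply: filterS (lt_na 1 isT) => e /=; apply: lt_trans.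
- move=> n n0; apply: filterS (lt_na n n0) => e /= lt_na'.
  exact: lt_le_trans (ler_norm _).
Qed.

Lemma negative_large_hreal (a : net R R) :
  hnegative (hreal a) /\ infinitely_large (hreal a) <->
  forall n, (0 < n)%N -> U [set e | n%:R < - a e].
Proof.
rewrite -(positive_large_hreal (fun e => - a e)).
rewrite hnegative_hreal hpositive_hreal !infinitely_large_hreal.
under [X in _ <-> U X /\ _]eq_set do rewrite oppr_gt0.
by under [X in _ <-> _ /\ X]eq_forall => n do
  under eq_set do rewrite normrN.
Qed.

(** Common core of the three equivalences, used with [f] the absolute value, the identity and the
    opposite. *)
Lemma bounded_image_netP (S : set R) (f : R -> R) :
  (forall n, (0 < n)%N -> U [set e : {posnum R} | e%:num < n%:R^-1]) ->
  (exists M, forall s, S s -> f s <= M) <->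
  ~ exists2 a : net R R, U [set e | S (a e)] &
      forall n, (0 < n)%N -> U [set e | n%:R < f (a e)].
Proof.
move=> U0; split=> [[M leM] [a Sa lt_na]|].
  (* The successor of the truncation is a positive natural number above [M]; a single [e] in the
     intersection then gives a contradiction. *)
  have [e /= [/leM le_faM]] :=
    filter_ex (filterI Sa (lt_na (Num.truncn M).+1 isT)).
  by move/lt_le_trans => /(_ _ le_faM); rewrite ltNge ltW // truncnS_gt.
apply: contra_notP => unbounded.
(* Each [1/e] fails to be an upper bound of [f] on [S], so a witness can be chosen for every [e]. *)
have /choice[a aP] : forall e : {posnum R}, exists s, S s /\ e%:num^-1 < f s.
  move=> e; apply: contra_notP unbounded => no_s; exists e%:num^-1 => s Ss.
  by rewrite leNgt; apply/negP => lt_efs; apply: no_s; exists s.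
exists a => [|n n0]; first by apply: filterS filterT => e _; case: (aP e).
(* Where [e < 1/n], the chain [n < 1/e < f (a e)] holds. *)
apply: filterS (U0 n n0) => e /= lt_en; apply: lt_trans (aP e).2.
by rewrite -[ltLHS]invrK ltf_pV2 // posrE ?invr_gt0 ?ltr0n.
Qed.

End HyperrealNets.

Theorem theorem3p4p1 (R : realType) (U : set_system {posnum R})
    (UU : UltraFilter U)
    (U0 : forall n : nat, (0 < n)%N ->
       U [set e : {posnum R} | e%:num < n%:R^-1])
    (S : set R) :
  [/\ bounded_reals S <-> starS U S `<=` hfinite U,
      has_ubound S <->
        ~ (exists x, [/\ starS U S x, hpositive x & infinitely_large x])
    & has_lbound S <->
        ~ (exists x, [/\ starS U S x, hnegative x & infinitely_large x])].
Proof.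
split.
- have -> : bounded_reals S <-> exists M, forall s, S s -> `|s| <= M.
    split=> [[M [_ leM]]|[M leM]]; first by exists M.
    (* [bounded_reals] demands a positive bound, hence the maximum with 1. *)
    exists (Num.max M 1); split; first by rewrite lt_max ltr01 orbT.
    by move=> s /leM le_sM; rewrite le_max le_sM.
  rewrite (bounded_image_netP S Num.norm U0).
  split=> [nlarge x /starSP[a -> Sa]|fin [a Sa lt_na]].
    apply/hfinite_not_large => /infinitely_large_hreal lt_na.
    by apply: nlarge; exists a.
  have /hfinite_not_large : hfinite U (hclass (fun e => (a e)%:C%C)).
    by apply: fin; apply/starSP; exists a.
  by apply; apply/infinitely_large_hreal.
- have -> : has_ubound S <-> exists M, forall s, S s -> s <= M by [].
  rewrite (bounded_image_netP S id U0); apply: not_iff_compat.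
  split=> [[a Sa /positive_large_hreal[a0 large_a]]|].
    by exists (hclass (fun e => (a e)%:C%C)); split=> //; apply/starSP; exists a.
  move=> [x [/starSP[a -> Sa] a0 large_a]]; exists a => //.
  exact/positive_large_hreal.
- have -> : has_lbound S <-> exists M, forall s, S s -> - s <= M.
    (* Lower bounds of [S] are the opposites of upper bounds of [- s]. *)
    by split=> -[M leM]; exists (- M) => s /leM; rewrite ?lerN2 // lerNl.
  rewrite (bounded_image_netP S -%R U0); apply: not_iff_compat.
  split=> [[a Sa /negative_large_hreal[a0 large_a]]|].
    by exists (hclass (fun e => (a e)%:C%C)); split=> //; apply/starSP; exists a.
  move=> [x [/starSP[a -> Sa] a0 large_a]]; exists a => //.
  exact/negative_large_hreal.
Qed.
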